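(* Let $M=\langle S,A,P,r,\mu,\gamma\rangle$ be a finite Markov decision process, $\phi$ a propositional logic formula over atomic propositions labelling the states, $p\in[0,1]$, and $\bowtie\,\in\{\le,\ge,>,<\}$. Define the cost function $d:S\times A\to\mathbb{R}$ by $d(s,a)=\mathbf{E}_{s'\sim P(\cdot\mid s,a)}\mathbf{1}(s'\models\phi)$ if $s\not\models\phi$, and $d(s,a)=0$ otherwise. Let all states in $\{s\in S\mid s\models\phi\}$ be sink states. Let $\pi$ be a Markov randomized policy, let $\epsilon\in(0,1)$ be a small constant, and let $T_\epsilon$ be an upper bound of the $\epsilon$-return mixing time of $\pi$. Then the $\pi$-induced Markov chain satisfies $M^\pi\models P_{\bowtie p}(\mathsf{True}\ \mathsf{U}\ \phi)$ if one of the following cases holds: - $\bowtie\,\in\{\ge,>\}$ and $D(X_0,T_\epsilon;\pi)\bowtie p$; - $\bowtie\,\in\{\le,<\}$ and $D(X_0,T_\epsilon;\pi)\bowtie p-\epsilon$.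
   Context: $S,A$ are finite, $P(\cdot\mid s,a)$ is the next-state distribution, $\mu$ the initial distribution. A state $s$ is a sink state if $P(s\mid s,a)=1$ for all admissible actions $a$ at $s$. A Markov randomized policy $\pi$ assigns to each state a distribution over admissible actions; $M^\pi=\{X_n,n\ge0\}$ with actions $A_n$ is the induced Markov chain, $X_0\sim\mu$, $A_t\sim\pi(\cdot\mid X_t)$, $X_{t+1}\sim P(\cdot\mid X_t,A_t)$. $s\models\phi$ means the state $s$ satisfies $\phi$. A path $s_0s_1s_2\ldots$ satisfies $\mathsf{True}\ \mathsf{U}\ \phi$ (''eventually $\phi$'') iff $s_j\models\phi$ for some $j\ge0$. $M^\pi\models P_{\bowtie p}(\psi)$ means that the probability that the path of $M^\pi$ started at $X_0$ satisfies $\psi$ is $\bowtie p$. $D(s,T;\pi)$ is the expected undiscounted total cost $\mathbf{E}_\pi\big[\sum_{t=0}^{T-1}d(X_t,A_t)\mid X_0=s\big]$, $T\in\mathbb{N}\cup\{\infty\}$ (the discount factor is set to $1$ for the cost), and $D(X_0,T;\pi)$ is the same quantity when starting at $X_0$. Mixing time: given $\epsilon>0$, the $\epsilon$-return mixing time of $\pi$ is the smallest $T$ such that for all $T'\ge T$ (and all $s\in S$), $|D(s,T';\pi)-D(s,T;\pi)|\le\epsilon$. (The paper introduces this notion for an ergodic policy $\pi$; here it is applied to the given $\pi$.)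
   Formalization: In the second case (≤, <) it is additionally assumed that the initial distribution μ gives probability 0 to states satisfying φ; without this the claim fails, since d charges nothing for a path that starts in φ. *)

(* Defs.v *)
From HB Require Import structures.
From mathcomp Require Import all_boot all_order all_algebra.
From mathcomp Require Import all_classical all_reals all_analysis.
Set Implicit Arguments. Unset Strict Implicit. Unset Printing Implicit Defensive.
Import Order.TTheory GRing.Theory Num.Theory.
Import numFieldNormedType.Exports.
Local Open Scope classical_set_scope.
Local Open Scope ring_scope.

Section markov_decision_process.
Context (R : realType).

Record dist (T : finType) := Dist {
  dist_fun :> T -> R;
  dist_ge0 : forall x, 0 <= dist_fun x;
  dist_sum1 : \sum_x dist_fun x = 1 }.

Lemma point_mass_ge0 (T : finType) (x y : T) : 0 <= (y == x)%:R :> R.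
Proof. exact: ler0n. Qed.

Lemma point_mass_sum1 (T : finType) (x : T) : \sum_y (y == x)%:R = 1 :> R.
Proof.
rewrite (bigD1 x)//= eqxx big1 ?addr0// => y /negbTE yx.
by rewrite yx.
Qed.

Definition point_mass (T : finType) (x : T) : dist T :=
  Dist (point_mass_ge0 x) (point_mass_sum1 x).

(* [trans] is total: its values at inadmissible pairs are never used, since
   policies only give weight to admissible actions. *)
Record mdp (S A : finType) := MDP {
  adm : S -> {set A};
  adm_ex : forall s, exists a, a \in adm s;
  trans : S -> A -> dist S;
  reward : S -> A -> R;
  init : dist S;
  discount : R;
  discount_itv : 0 <= discount <= 1 }.

Definition sink (S A : finType) (M : mdp S A) (s : S) : Prop :=
  forall a, a \in adm M s -> trans M s a s = 1.

Record policy (S A : finType) (M : mdp S A) := Policy {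
  policy_dist :> S -> dist A;
  policy_adm : forall s a, a \notin adm M s -> policy_dist s a = 0 }.

End markov_decision_process.

Inductive formula (AP : Type) :=
  | FTrue
  | FAtom of AP
  | FNot of formula AP
  | FAnd of formula AP & formula AP.
Arguments FTrue {AP}.

Fixpoint sat (AP S : Type) (L : S -> AP -> bool) (s : S) (phi : formula AP) : bool :=
  match phi with
  | FTrue => true
  | FAtom p => L s p
  | FNot f => ~~ sat L s f
  | FAnd f g => sat L s f && sat L s g
  end.

Section runs.
Context (R : realType) (S A : finType).
Implicit Type M : mdp R S A.

Lemma mdp_state_action M : {x : S * A | True}.
Proof.
apply: cid; have [s] : exists s : S, True.
  apply: contrapT => noS; have := dist_sum1 (init M).
  rewrite big1 => [/eqP|s _]; last by case: noS; exists s.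
  by rewrite eq_sym oner_eq0.
by have [a _] := adm_ex M s; exists (s, a).
Qed.

(* [w n = (X_n, A_n)]. The argument [M] only serves to show that the type is
   inhabited, as required of a measurable space. *)
Definition run M : Type := nat -> S * A.

HB.instance Definition _ M := Choice.copy (run M) (nat -> S * A).
HB.instance Definition _ M :=
  isPointed.Build (run M) (fun=> projT1 (mdp_state_action M)).

(* The runs agreeing with [w] on the first [n] states and actions. *)
Definition cylinder M (w : run M) (n : nat) : set (run M) :=
  [set v | forall i, (i < n)%N -> v i = w i].

Definition cylinders M : set (set (run M)) :=
  [set C | exists w n, C = cylinder w n].

Definition run_space M := g_sigma_algebraType (@cylinders M).

(* The finite-dimensional distributions of X_0 ~ nu, A_t ~ pi(.|X_t),
   X_{t+1} ~ P(.|X_t, A_t). They determine [Pr] ([is_run_law_unique]), and such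
   a [Pr] exists ([run_law_ex]). *)
Definition is_run_law M (pi : policy M) (nu : dist R S)
    (Pr : probability (run_space M) R) : Prop :=
  forall (w : run M) n, Pr (cylinder w n.+1) =
    (nu (w 0%N).1 * pi (w 0%N).1 (w 0%N).2 *
     \prod_(i < n) (trans M (w i).1 (w i).2 (w i.+1).1 *
                    pi (w i.+1).1 (w i.+1).2))%:E.

End runs.

(* Existence: the histories of length [n] are realized as consecutive
   half-open subintervals of [0, 1[ whose lengths are their probabilities. *)
Section realization.
Context (R : realType) (K : finType) (k0 : K) (F : seq K -> K -> R).
Hypothesis F_ge0 : forall h k, 0 <= F h k.
Hypothesis F_sum1 : forall h, \sum_k F h k = 1.

Let cum h i := \sum_(0 <= j < i) F h (nth k0 (enum K) j).

Let le_cum h i j : (i <= j)%N -> cum h i <= cum h j.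
Proof.
move=> ij; rewrite /cum (big_cat_nat (leq0n i) ij)//= lerDl sumr_ge0//.
Qed.

Let cum_top h : cum h #|K| = 1.
Proof.
rewrite /cum -(F_sum1 h) cardE -(big_nth k0 predT (F h)).
by rewrite big_enum.
Qed.

Fixpoint hist_weight (h : seq K) : R :=
  if h is k :: h' then hist_weight h' * F h' k else 1.

Let wt := hist_weight.

Let wt_ge0 h : 0 <= wt h.
Proof. by elim: h => //= k h IH; rewrite mulr_ge0. Qed.

Fixpoint lo (h : seq K) : R :=
  if h is k :: h' then lo h' + wt h' * cum h' (index k (enum K)) else 0.

Let I h : set R := `[lo h, lo h + wt h[.

Let cumS h k : cum h (index k (enum K)).+1 = cum h (index k (enum K)) + F h k.
Proof. by rewrite /cum big_nat_recr//= nth_index// mem_enum. Qed.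

Let hi_cons k h :
  lo (k :: h) + wt (k :: h) = lo h + wt h * cum h (index k (enum K)).+1.
Proof. by rewrite /= cumS mulrDr addrA. Qed.

Let index_lt k : (index k (enum K) < #|K|)%N.
Proof. by rewrite cardE index_mem mem_enum. Qed.

Let I_sub k h u : I (k :: h) u -> I h u.
Proof.
rewrite /I /= !in_itv/= hi_cons => /andP[l r]; apply/andP; split.
  apply: le_trans l; rewrite lerDl mulr_ge0// /cum sumr_ge0//.
apply: (lt_le_trans r); rewrite lerD2l -[leRHS]mulr1 ler_wpM2l//.
by rewrite -(cum_top h) le_cum.
Qed.

Let I_uniq k j h u : I (k :: h) u -> I (j :: h) u -> k = j.
Proof.
have aux a b : (index a (enum K) < index b (enum K))%N ->
    I (a :: h) u -> I (b :: h) u -> False.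
  move=> ab; rewrite /I /= !in_itv/= !hi_cons => /andP[_ l] /andP[r _].
  suff : u < u by rewrite ltxx.
  by apply: lt_le_trans l (le_trans _ r); rewrite lerD2l ler_wpM2l// le_cum.
move=> Ik Ij; have [kj|jk|e] := ltngtP (index k (enum K)) (index j (enum K)).
- by case: (aux _ _ kj Ik Ij).
- by case: (aux _ _ jk Ij Ik).
rewrite -(nth_index k0 (_ : k \in enum K)) ?mem_enum// e.
by rewrite nth_index// mem_enum.
Qed.

Let I_ex h u : I h u -> exists k, I (k :: h) u.
Proof.
rewrite /I/= in_itv/= => /andP[l].
rewrite -[X in _ + X]mulr1 -(cum_top h) => r.
have [i iK /andP[li ri]] : exists2 i, (i < #|K|)%N &
    (lo h + wt h * cum h i <= u < lo h + wt h * cum h i.+1).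
  elim: #|K| r => [|N IH] r.
    by move: r; rewrite /cum big_geq// mulr0 addr0 ltNge l.
  have [r'|r'] := ltP u (lo h + wt h * cum h N).
    by have [i iN ?] := IH r'; exists i => //; exact: ltnW.
  by exists N => //; rewrite r' r.
exists (nth k0 (enum K) i) => /=.
have ii : index (nth k0 (enum K) i) (enum K) = i.
  by rewrite index_uniq ?enum_uniq// -cardE.
by rewrite in_itv/= hi_cons/= ii li ri.
Qed.

Let next u h := odflt k0 [pick k | `[< I (k :: h) u >]].

Let nextP u h k : I (k :: h) u -> next u h = k.
Proof.
rewrite /next => Ik; case: pickP => [j /asboolP Ij|/(_ k)/asboolP//].
by apply: I_uniq Ij Ik.
Qed.

Fixpoint hist u n : seq K := if n is m.+1 then next u (hist u m) :: hist u m else [::].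

Let measurable_next h k : measurable [set u | next u h = k].
Proof.
have -> : [set u | next u h = k] = I (k :: h) `|`
    (~` (\bigcup_(j in [set: K]) I (j :: h)) `&` [set _ | k0 = k]).
  apply/seteqP; split => u /=; rewrite /next.
    case: pickP => [j /asboolP Ij /= <-|no /= ->]; first by left.
    by right; split => // -[j _ Ij]; have /asboolP := no j.
  move=> [|[no ->]]; first exact: nextP.
  by case: pickP => //= j /asboolP Ij; case: no; exists j.
apply: measurableU; first exact: measurable_itv.
apply: measurableI; last first.
  have [e|ne] := pselect (k0 = k).
    by rewrite (_ : [set _ | _] = setT)//; apply/seteqP; split.
  by rewrite (_ : [set _ | _] = set0)//; apply/seteqP; split.
apply: measurableC; apply: fin_bigcup_measurable; first exact: finite_finset.
by move=> j _; exact: measurable_itv.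
Qed.

Lemma measurable_hist n h : measurable [set u | hist u n = h].
Proof.
elim: n h => [|n IH] [|k h] /=.
- by rewrite (_ : [set _ | _] = setT)//; apply/seteqP; split.
- by rewrite (_ : [set _ | _] = set0)//; apply/seteqP; split.
- by rewrite (_ : [set _ | _] = set0)//; apply/seteqP; split.
rewrite (_ : [set u | _] = [set u | next u h = k] `&` [set u | hist u n = h]).
  exact: measurableI.
by apply/seteqP; split => u /= [<- <-].
Qed.

Lemma hist_measure n h : size h = n ->
  lebesgue_measure ([set u | hist u n = h] `&` `[0, 1[) = (wt h)%:E :> \bar R.
Proof.
move=> hn; have -> : [set u | hist u n = h] `&` `[0, 1[ = I h.
  have inI u m : u \in `[0, 1[ -> I (hist u m) u.
    move=> u01; elim: m => [|m IH]; first by rewrite /I/= add0r.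
    by have [k Ik] := I_ex IH; rewrite /= (nextP Ik).
  apply/seteqP; split => [u [/= <-]|u]; first by move/inI; exact.
  elim: h n hn => [|k h IH] [|n]//= => [_|[hn]] Iu.
    by rewrite /I/= add0r in Iu.
  have [/= -> u01] := IH n hn (I_sub Iu); split => //.
  by rewrite (nextP Iu).
rewrite /I lebesgue_measure_itv/= lte_fin; case: ifPn => [_|].
  by rewrite -EFinD addrAC subrr add0r.
by rewrite ltrDl -leNgt => w0; congr EFin; apply/eqP; rewrite eq_le wt_ge0 w0.
Qed.

End realization.

Section run_law.
Context (R : realType) (S A : finType).
Implicit Type M : mdp R S A.

Definition half_open_unit : set (measurableTypeR R) := `[0, 1[.

Lemma measurable_half_open_unit : measurable half_open_unit.
Proof. exact: measurable_itv. Qed.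

Definition unit_measure := mrestr lebesgue_measure measurable_half_open_unit.

HB.instance Definition _ := Measure.on unit_measure.

Lemma unit_measure_setT : unit_measure setT = 1%E.
Proof.
by rewrite /unit_measure /mrestr setTI lebesgue_measure_itv/= lte_fin ltr01
  sube0.
Qed.

HB.instance Definition _ :=
  Measure_isProbability.Build _ _ _ unit_measure unit_measure_setT.

Lemma run_law_ex M (pi : policy M) (nu : dist R S) :
  exists Pr, is_run_law pi nu Pr.
Proof.
pose k0 := projT1 (mdp_state_action M).
pose F (h : seq (S * A)) (k : S * A) : R :=
  (if h is k' :: _ then trans M k'.1 k'.2 k.1 else nu k.1) * pi k.1 k.2.
have F0 h k : 0 <= F h k.
  by rewrite /F mulr_ge0//; [case: h => [|? ?]|]; exact: dist_ge0.
have F1 h : \sum_k F h k = 1.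
  pose g := if h is k' :: _ then trans M k'.1 k'.2 else nu.
  rewrite (eq_bigr (fun k => g k.1 * pi k.1 k.2)); last first.
    by move=> k _; rewrite /F {}/g; case: h.
  rewrite -(pair_bigA _ (fun s a => g s * pi s a))/=.
  under eq_bigr do rewrite -mulr_sumr dist_sum1 mulr1.
  exact: dist_sum1.
pose f (u : measurableTypeR R) : run_space M :=
  fun n => head k0 (hist k0 F u n.+1).
pose pre (v : run M) n := rev (mkseq v n).
have preS v n : pre v n.+1 = v n :: pre v n.
  by rewrite /pre mkseqS rev_rcons.
have preE u n : pre (f u) n = hist k0 F u n.
  by elim: n => [|n IH]//; rewrite preS IH.
have cylE (w : run M) n : f @^-1` cylinder w n = [set u | hist k0 F u n = pre w n].
  apply/seteqP; split => u; rewrite /cylinder/= -preE.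
    move=> H; congr rev; apply: (@eq_from_nth _ k0); rewrite !size_mkseq// => i ni.
    by rewrite !nth_mkseq// H.
  move=> /(can_inj revK) e i ni; have := congr1 (fun s => nth k0 s i) e.
  by rewrite !nth_mkseq.
have mf : measurable_fun [set: measurableTypeR R] f.
  apply: (@measurability _ _ (measurableTypeR R) (run_space M) setT f (@cylinders R S A M)) => // _ [_ [w [n ->]] <-].
  by rewrite setTI cylE; exact: measurable_hist.
exists (distribution unit_measure (mfun_Sub (mem_set mf))) => w n.
rewrite /distribution /pushforward/= cylE.
rewrite /unit_measure /mrestr hist_measure//; last by rewrite size_rev size_mkseq.
congr EFin; elim: n => [|n IH].
  by rewrite preS /= mul1r big_ord0 mulr1.
by rewrite preS /= IH big_ord_recr/= mulrA preS.
Qed.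

Lemma is_run_law_unique M (pi : policy M) nu Pr1 Pr2 :
  is_run_law pi nu Pr1 -> is_run_law pi nu Pr2 ->
  forall E, measurable E -> Pr1 E = Pr2 E.
Proof.
move=> H1 H2 E mE.
pose G : set (set (run_space M)) := @cylinders R S A M `|` [set set0].
have mG : (@measurable _ (run_space M)) = <<s G >>.
  rewrite eqEsubset; split; first exact: sub_smallest2r (@subsetUl _ _ _).
  apply: smallest_sub; first exact: sigma_algebra_measurable.
  by move=> C [|->]; [exact: sub_sigma_algebra|exact: measurable0].
pose w0 : run M := point.
apply: (measure_unique G (fun=> cylinder w0 0)) => //.
- move=> C D [[v [n ->]]|->]; last by right; rewrite set0I.
  case=> [[w [m ->]]|->]; last by right; rewrite setI0.
  have [->|/set0P[x [xv xw]]] := eqVneq (cylinder v n `&` cylinder w m) set0.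
    by right.
  left; exists x, (maxn n m); apply/seteqP; split => y /=.
    move=> [yv yw] i; rewrite leq_max => /orP[ni|mi].
      by rewrite yv// xv.
    by rewrite yw// xw.
  move=> yx; split => i ni; rewrite yx ?leq_max ?ni ?orbT//.
    exact: xv.
  exact: xw.
- by move=> _; left; exists w0, 0%N.
- by apply/seteqP; split => // x _; exists 0%N.
- move=> C [[w [[|n] ->]]|->]; last by rewrite !measure0.
    have -> : cylinder w 0 = [set: run_space M] by apply/seteqP; split.
    exact: etrans (probability_setT Pr1) (esym (probability_setT Pr2)).
  exact: etrans (H1 w n) (esym (H2 w n)).
- by move=> _; rewrite (le_lt_trans (probability_le1 _ _)) ?ltry//;
    apply: sub_sigma_algebra; exists w0, 0%N.
Qed.

Definition run_law M (pi : policy M) (nu : dist R S) :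
  probability (run_space M) R := projT1 (cid (run_law_ex pi nu)).

Lemma run_lawP M (pi : policy M) (nu : dist R S) :
  is_run_law pi nu (run_law pi nu).
Proof. exact: projT2 (cid (run_law_ex pi nu)). Qed.

End run_law.

Section cost.
Context (R : realType) (S A : finType) (M : mdp R S A) (pi : policy M).

Definition total_cost (d : S -> A -> R) (T : nat) (w : run_space M) : R :=
  \sum_(t < T) d (w t).1 (w t).2.

(* For [nu = point_mass R s] this is D(s, T; pi), without conditioning on an
   event X_0 = s that [init M] may give probability 0; for [nu = init M] it is
   D(X_0, T; pi). *)
Definition expected_cost (d : S -> A -> R) (nu : dist R S) (T : nat) : \bar R :=
  ('E_(run_law pi nu)[total_cost d T])%E.

Definition return_mixed (d : S -> A -> R) (eps : R) (T : nat) : Prop :=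
  forall T' s, (T <= T')%N ->
    (`|expected_cost d (point_mass R s) T' - expected_cost d (point_mass R s) T|
       <= eps%:E)%E.

Definition is_return_mixing_time (d : S -> A -> R) (eps : R) (T : nat) : Prop :=
  return_mixed d eps T /\ forall T', return_mixed d eps T' -> (T <= T')%N.

End cost.

Section reachability.
Context (R : realType) (S A : finType) (AP : Type) (M : mdp R S A).
Context (L : S -> AP -> bool).

Definition reach_cost (phi : formula AP) (s : S) (a : A) : R :=
  if sat L s phi then 0 else \sum_s' trans M s a s' * (sat L s' phi)%:R.

(* The paths satisfying [True U phi]. *)
Definition eventually_sat (phi : formula AP) : set (run_space M) :=
  [set w | exists j, sat L (w j).1 phi].

End reachability.
Arguments reach_cost {R S A AP} M L phi s a.
Arguments eventually_sat {R S A AP} M L phi.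

Variant comparison := cmp_le | cmp_ge | cmp_gt | cmp_lt.

Definition compare_with (R : realType) (b : comparison) (x y : \bar R) : Prop :=
  match b with
  | cmp_le => (x <= y)%E
  | cmp_ge => (x >= y)%E
  | cmp_gt => (x > y)%E
  | cmp_lt => (x < y)%E
  end.

(* [M^pi |= P_{b p}(True U phi)]. *)
Definition models_eventually (R : realType) (S A : finType) (AP : Type)
    (M : mdp R S A) (L : S -> AP -> bool) (pi : policy M)
    (b : comparison) (p : R) (phi : formula AP) : Prop :=
  compare_with b (run_law pi (init M) (eventually_sat M L phi)) p%:E.

(* Main.v *)
Require Import Defs.
From mathcomp Require Import all_boot all_order all_algebra.
From mathcomp Require Import all_classical all_reals all_analysis.
From mathcomp Require Import measurable_realfun.
Local Open Scope ring_scope.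

Set Implicit Arguments. Unset Strict Implicit. Unset Printing Implicit Defensive.
Import Order.TTheory GRing.Theory Num.Theory.
Local Open Scope classical_set_scope.

(** The cost of a pair is the probability of entering the target at the next
    step, and it vanishes on the target. As target states are sinks, a run that
    has entered the target almost surely stays there, so the mass of the target
    at time [t] grows at each step exactly by the expected cost of that step
    ([sat_massS]). Telescoping gives [sat_massE]: the probability that [X_T] is
    in the target equals the probability that [X_0] is, plus the expected total
    cost [D(X_0, T)].

    For a lower bound, [X_T] being in the target implies that the target is
    eventually reached, so [D(X_0, Teps)] bounds the reachability probability
    from below. For an upper bound, the reachability probability is the limit
    of the masses of the target ([eventually_le]), which start from mass [0]
    because [X_0] is not in the target. Beyond the mixing time the total cost
    increases by at most [eps] from each initial state, hence, by linearity in
    the initial distribution ([reach_total_linear]), from [init M] as well. The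
    total cost is nondecreasing in the horizon, so [Teps] may replace the mixing
    time itself, and the reachability probability is at most
    [D(X_0, Teps) + eps].

    The law of a run is given on cylinders only. The one-step Markov property
    [run_law_step] is lifted from cylinders to the coordinates by splitting an
    event according to the values of earlier coordinates ([history_ind]); it
    yields the recursion [occ] for the law of [(X_t, A_t)], in terms of which
    everything else is a finite sum. *)

(** * The one-dimensional laws of a run *)

Section law_of_the_chain.
Context (R : realType) (S A : finType) (M : mdp R S A).

Definition at_time (n : nat) (k : S * A) : set (run_space M) :=
  [set w | w n = k].

Definition update (w : run M) (n : nat) (k : S * A) : run M :=
  fun i => if i == n then k else w i.

Lemma cylinderS (w : run M) n k :
  cylinder w n `&` at_time n k = cylinder (update w n k) n.+1.
Proof.
apply/seteqP; split=> v; rewrite /cylinder /at_time /update /=.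
  move=> [vw vn] i; rewrite ltnS leq_eqVlt; case: eqVneq => [->//|_ /= lti].
  exact: vw.
move=> vw; split=> [i lti|]; last by rewrite vw ?eqxx.
by rewrite vw ?ltn_eqF//; exact: ltnW.
Qed.

(** Reduces a property of the whole space to cylinders of a fixed length [n],
    by cutting along the coordinates [n - 1], ..., [0] in turn. *)
Lemma history_ind n (Q : set (run_space M) -> Prop) :
    (forall w : run M, Q (cylinder w n)) ->
    (forall m C, (forall k, Q (C `&` at_time m k)) -> Q C) ->
  Q setT.
Proof.
move=> Qn Qsplit; elim: n Qn => [|n IH] Qn.
  rewrite (_ : setT = cylinder (point : run M) 0); first exact: Qn.
  by apply/seteqP; split.
apply: IH => w; apply: (Qsplit n) => k; rewrite cylinderS; exact: Qn.
Qed.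

Lemma at_time_cover n (C : set (run_space M)) :
  C = \bigcup_(k in [set` enum {: S * A}]) (C `&` at_time n k).
Proof.
apply/seteqP; split=> [w Cw|w [k _ []]//].
by exists (w n); rewrite /= ?mem_enum.
Qed.

Lemma measurable_cylinder (w : run M) n :
  measurable (cylinder w n : set (run_space M)).
Proof. by apply: sub_sigma_algebra; exists w, n. Qed.

Lemma measurable_split n (C : set (run_space M)) :
  (forall k, measurable (C `&` at_time n k)) -> measurable C.
Proof.
move=> mC; rewrite (at_time_cover n C).
by apply: fin_bigcup_measurable => // i _; exact: mC.
Qed.

(** A coordinate event meets a cylinder that fixes that coordinate in the whole
    cylinder or not at all. *)
Lemma measurable_at_time n k : measurable (at_time n k).
Proof.
rewrite -[at_time n k]setTI.
apply: (@history_ind n.+1 (fun C => measurable (C `&` at_time n k))).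
  move=> w; have [wn|wn] := eqVneq (w n) k.
    rewrite (_ : _ `&` _ = cylinder w n.+1); first exact: measurable_cylinder.
    by apply/seteqP; split=> [v []//|v vw]; split=> //; rewrite /at_time /= vw.
  rewrite (_ : _ `&` _ = set0)//; apply/seteqP; split=> // v [vw].
  by rewrite /at_time /= vw// => /eqP; rewrite (negbTE wn).
move=> m C mC; apply: (@measurable_split m) => j.
by rewrite setIAC.
Qed.

Lemma measurable_state n (B : pred S) :
  measurable ([set w | B (w n).1] : set (run_space M)).
Proof.
apply: (@measurable_split n) => k.
rewrite (_ : _ `&` _ = if B k.1 then at_time n k else set0).
  by case: ifP => // _; exact: measurable_at_time.
apply/seteqP; rewrite /at_time; case: ifPn => Bk; split=> w //=.
- by case.
- by move=> wk; rewrite wk.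
- by move=> -[+ wk]; rewrite wk (negbTE Bk).
Qed.

Variables (pi : policy M) (nu : dist R S).

Lemma probability_split n (C : set (run_space M)) : measurable C ->
  (run_law pi nu C = \sum_k run_law pi nu (C `&` at_time n k))%E.
Proof.
move=> mC; rewrite {1}(at_time_cover n C) measure_fin_bigcup//=.
- by rewrite -fsbig_seq ?enum_uniq// big_enum.
- move=> i j _ _ [w [[_ wi] [_ wj]]].
  by rewrite /at_time /= in wi wj; rewrite -wi -wj.
- by move=> i _; apply: measurableI => //; exact: measurable_at_time.
Qed.

Definition step (j k : S * A) : R := trans M j.1 j.2 k.1 * pi k.1 k.2.

(** The Markov property. Inside a cylinder of length [t + 1] that ends in [j]
    it is a quotient of two values given by [is_run_law]; both sides are
    additive, so it passes to the whole space. *)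
Lemma run_law_step t j k :
  (run_law pi nu (at_time t j `&` at_time t.+1 k) =
   run_law pi nu (at_time t j) * (step j k)%:E)%E.
Proof.
suff [_] : measurable [set: run_space M] /\
    (run_law pi nu (setT `&` (at_time t j `&` at_time t.+1 k)) =
     run_law pi nu (setT `&` at_time t j) * (step j k)%:E)%E.
  by rewrite !setTI.
apply: (@history_ind t.+1 (fun C => measurable C /\
  (run_law pi nu (C `&` (at_time t j `&` at_time t.+1 k)) =
   run_law pi nu (C `&` at_time t j) * (step j k)%:E)%E)) => [w|m C QC].
  split; first exact: measurable_cylinder.
  rewrite setIA; have [wt|wt] := eqVneq (w t) j; last first.
    rewrite (_ : _ `&` at_time t j = set0) ?set0I ?measure0 ?mul0e//.
    apply/seteqP; split=> // v [vw].
    by rewrite /at_time /= vw// => /eqP; rewrite (negbTE wt).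
  have -> : cylinder w t.+1 `&` at_time t j = cylinder w t.+1.
    by apply/seteqP; split=> [v []//|v vw]; split=> //; rewrite /at_time /= vw.
  rewrite cylinderS !(run_lawP pi nu _ _) -EFinM big_ord_recr /= mulrA /step.
  rewrite /update /= eqxx (ltn_eqF (ltnSn t)) wt.
  congr ((_ * _ * _) %:E); apply: eq_bigr => i _.
  by rewrite eqSS (ltn_eqF (ltn_ord i)) (ltn_eqF (ltn_trans (ltn_ord i) _)).
have mC : measurable C by apply: (@measurable_split m) => i; case: (QC i).
split=> //; have mat := measurable_at_time.
rewrite (@probability_split m); last by apply: measurableI => //; exact: measurableI.
rewrite (@probability_split m (C `&` _)); last exact: measurableI.
rewrite ge0_sume_distrl//; apply: eq_bigr => i _.
by rewrite setIAC [in RHS]setIAC; case: (QC i).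
Qed.

(** The law of [(X_t, A_t)], by the forward equation (see [occE]). *)
Fixpoint occ (t : nat) (k : S * A) : R :=
  if t is t'.+1 then \sum_j occ t' j * step j k else nu k.1 * pi k.1 k.2.

Lemma occE t k : run_law pi nu (at_time t k) = (occ t k)%:E.
Proof.
elim: t k => [|t IH] k.
  have -> : at_time 0 k = cylinder ((fun=> k) : run M) 1.
    by apply/seteqP; split=> [v vk []//|v]; exact.
  by rewrite (run_lawP pi nu _ _) big_ord0 mulr1.
rewrite (@probability_split t); last exact: measurable_at_time.
rewrite /= -sumEFin; apply: eq_bigr => j _.
by rewrite setIC run_law_step IH EFinM.
Qed.

Lemma occ_ge0 t k : 0 <= occ t k.
Proof. by rewrite -lee_fin -occE measure_ge0. Qed.

Lemma occ_inadmissible t k : k.2 \notin adm M k.1 -> occ t k = 0.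
Proof.
move=> /(policy_adm pi) pk; case: t => [|t] /=; first by rewrite pk mulr0.
by rewrite big1// => j _; rewrite /step pk !mulr0.
Qed.

Lemma prob_stateE t (B : pred S) :
  run_law pi nu [set w | B (w t).1] = (\sum_(k | B k.1) occ t k)%:E.
Proof.
rewrite (@probability_split t); last exact: measurable_state.
rewrite [in RHS]big_mkcond -sumEFin; apply: eq_bigr => k _.
case: ifPn => Bk; rewrite -?occE; last first.
  rewrite (_ : _ `&` _ = set0) ?measure0//; apply/seteqP; split=> // w [/= + wk].
  by rewrite wk (negbTE Bk).
congr (run_law pi nu _); rewrite /at_time; apply/seteqP; split=> [w []//|w /= wk].
by rewrite wk.
Qed.

(** The total cost is a finite nonnegative combination of the indicators of the
    events [at_time t k], which can be integrated term by term. *)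
Lemma expected_costE (d : S -> A -> R) T : (forall s a, 0 <= d s a) ->
  expected_cost pi d nu T = (\sum_(t < T) \sum_k occ t k * d k.1 k.2)%:E.
Proof.
move=> d0; rewrite /expected_cost unlock.
have tE (w : run_space M) : (total_cost d T w)%:E =
    (\sum_(i <- enum {: 'I_T * (S * A)})
      (d i.2.1 i.2.2)%:E * (\1_(at_time i.1 i.2) w)%:E)%E.
  rewrite big_enum /= -(pair_bigA _ (fun (t : 'I_T) k =>
     (d k.1 k.2)%:E * (\1_(at_time t k) w)%:E)%E) /= /total_cost -sumEFin.
  apply: eq_bigr => t _; rewrite (bigD1 (w t))//= big1 ?adde0 => [|k kw].
    by rewrite indicE mem_set// mule1.
  rewrite indicE memNset ?mule0// /at_time /= => wk.
  by rewrite wk eqxx in kw.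
under eq_integral do rewrite tE.
have mi (i : 'I_T * (S * A)) : measurable_fun [set: run_space M]
    (fun w : run_space M => (\1_(at_time i.1 i.2) w)%:E).
  by apply/measurable_EFinP; apply: measurable_indic; exact: measurable_at_time.
rewrite ge0_integral_sum//; last 2 first.
- by move=> i; apply: measurable_funeM.
- by move=> i w _; rewrite -EFinM lee_fin mulr_ge0// indicE ler0n.
rewrite big_enum /= (eq_bigr (fun i : 'I_T * (S * A) => (occ i.1 i.2 * d i.2.1 i.2.2)%:E)).
  by rewrite pair_bigA/= sumEFin.
move=> i _; rewrite ge0_integralZl_EFin//.
rewrite integral_indic ?setIT; [|exact: measurableT|exact: measurable_at_time].
by rewrite [X in (_ * X)%E]occE -EFinM mulrC.
Qed.

End law_of_the_chain.

(** * Reaching an absorbing target *)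

Section absorbing_target.
Context (R : realType) (S A : finType) (M : mdp R S A).

Lemma dist_eq1 (T : finType) (q : dist R T) (x y : T) :
  q x = 1 -> y != x -> q y = 0.
Proof.
move=> qx yx; have := dist_sum1 q; rewrite (bigD1 x)//= qx => /eqP.
rewrite addrC -subr_eq0 addrK psumr_eq0; last by move=> i _; exact: dist_ge0.
by move=> /allP /(_ y); rewrite mem_index_enum yx => /(_ isT) /eqP.
Qed.

Lemma occ_linear (pi : policy M) (nu : dist R S) t k :
  occ pi nu t k = \sum_s nu s * occ pi (point_mass R s) t k.
Proof.
elim: t k => [|t IH] k /=.
  rewrite (bigD1 k.1)//= eqxx mul1r big1 ?addr0// => s sk.
  by rewrite eq_sym (negbTE sk) mul0r mulr0.
under eq_bigr => j _ do rewrite IH mulr_suml.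
rewrite exchange_big /=; apply: eq_bigr => s _.
by rewrite mulr_sumr; apply: eq_bigr => j _; rewrite mulrA.
Qed.

Context (AP : Type) (L : S -> AP -> bool) (phi : formula AP) (pi : policy M).
Hypothesis target_sink : forall s, sat L s phi -> sink M s.

Definition sat_mass (nu : dist R S) (t : nat) : R :=
  \sum_(k | sat L k.1 phi) occ pi nu t k.

Definition reach_total (nu : dist R S) (T : nat) : R :=
  \sum_(t < T) \sum_k occ pi nu t k * reach_cost M L phi k.1 k.2.

Lemma reach_cost_ge0 s a : 0 <= reach_cost M L phi s a.
Proof.
rewrite /reach_cost; case: ifP => // _.
by apply: sumr_ge0 => s' _; rewrite mulr_ge0 ?dist_ge0.
Qed.

Lemma expected_reach_costE nu T :
  expected_cost pi (reach_cost M L phi) nu T = (reach_total nu T)%:E.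
Proof. by rewrite expected_costE//; exact: reach_cost_ge0. Qed.

(** Transfers to [nu] the bounds that the mixing time gives for each
    deterministic initial state. *)
Lemma reach_total_linear nu T :
  reach_total nu T = \sum_s nu s * reach_total (point_mass R s) T.
Proof.
under [RHS]eq_bigr => s _ do rewrite mulr_sumr.
rewrite exchange_big /=; apply: eq_bigr => t _.
under [RHS]eq_bigr => s _ do rewrite mulr_sumr.
rewrite exchange_big /=; apply: eq_bigr => k _.
by rewrite occ_linear mulr_suml; apply: eq_bigr => s _; rewrite mulrA.
Qed.

Lemma le_reach_total nu T T' : (T <= T')%N -> reach_total nu T <= reach_total nu T'.
Proof.
move=> /subnKC <-; rewrite /reach_total big_split_ord /= lerDl.
by apply: sumr_ge0 => t _; apply: sumr_ge0 => k _;
  rewrite mulr_ge0 ?occ_ge0 ?reach_cost_ge0.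
Qed.

Lemma step_sat j :
  \sum_(k | sat L k.1 phi) step pi j k =
  \sum_s trans M j.1 j.2 s * (sat L s phi)%:R.
Proof.
rewrite big_mkcond /=.
rewrite (eq_bigr (fun k : S * A =>
  trans M j.1 j.2 k.1 * (sat L k.1 phi)%:R * pi k.1 k.2)); last first.
  by move=> k _; rewrite /step; case: ifP => _; rewrite ?mulr1 ?mulr0 ?mul0r.
rewrite -(pair_bigA _ (fun s a =>
  trans M j.1 j.2 s * (sat L s phi)%:R * pi s a)) /=.
by apply: eq_bigr => s _; rewrite -mulr_sumr dist_sum1 mulr1.
Qed.

(** Either the action at [j] is admissible, and the sink [j.1] has no other
    successor, or the policy never takes it. *)
Lemma occ_step_leave0 nu t j k : sat L j.1 phi -> ~~ sat L k.1 phi ->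
  occ pi nu t j * step pi j k = 0.
Proof.
move=> Bj Bk; have [aj|/occ_inadmissible->] := boolP (j.2 \in adm M j.1).
  rewrite /step (dist_eq1 (target_sink Bj aj)) ?mul0r ?mulr0//.
  by apply: contraNneq Bk => ->.
by rewrite mul0r.
Qed.

(** Pairs outside the target contribute their probability of entering it, which
    is their cost; pairs in the target keep all their mass in it. *)
Lemma sat_massS nu t : sat_mass nu t.+1 =
  sat_mass nu t + \sum_k occ pi nu t k * reach_cost M L phi k.1 k.2.
Proof.
rewrite /sat_mass /= exchange_big [in RHS]big_mkcond -big_split /=.
apply: eq_bigr => j _; rewrite -mulr_sumr step_sat /reach_cost.
case: ifPn => Bj; last by rewrite add0r.
rewrite mulr0 addr0.
have [aj|/occ_inadmissible->] := boolP (j.2 \in adm M j.1); last by rewrite mul0r.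
rewrite (bigD1 j.1)//= (target_sink Bj aj) Bj mulr1 big1 ?addr0 ?mulr1// => s sj.
by rewrite (dist_eq1 (target_sink Bj aj) sj) mul0r.
Qed.

Lemma sat_massE nu T : sat_mass nu T = sat_mass nu 0 + reach_total nu T.
Proof.
elim: T => [|T IH]; first by rewrite /reach_total big_ord0 addr0.
by rewrite sat_massS IH /reach_total big_ord_recr addrA.
Qed.

Lemma sat_mass_ge0 nu t : 0 <= sat_mass nu t.
Proof. by apply: sumr_ge0 => k _; exact: occ_ge0. Qed.

Definition hit (t : nat) : set (run_space M) := [set w | sat L (w t).1 phi].

Lemma measurable_hit t : measurable (hit t).
Proof. exact: (@measurable_state _ _ _ M t (fun s => sat L s phi)). Qed.

Lemma prob_hit nu t : run_law pi nu (hit t) = (sat_mass nu t)%:E.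
Proof. exact: (@prob_stateE _ _ _ M pi nu t (fun s => sat L s phi)). Qed.

(** Splitting on the pairs at times [t] and [t + 1], each piece is empty or is
    null by [occ_step_leave0]. *)
Lemma prob_leave nu t : run_law pi nu (hit t `\` hit t.+1) = 0%E.
Proof.
have mD : measurable (hit t `\` hit t.+1).
  by apply: measurableD; exact: measurable_hit.
have mat n k := @measurable_at_time _ _ _ M n k.
rewrite (@probability_split _ _ _ _ pi nu t)// big1// => j _.
rewrite (@probability_split _ _ _ _ pi nu t.+1); last exact: measurableI.
rewrite big1// => k _; set C := (X in run_law _ _ X).
have mC : measurable C by apply: measurableI => //; exact: measurableI.
have [/andP[Bj Bk]|jk] := boolP (sat L j.1 phi && ~~ sat L k.1 phi).
  apply: (@subset_measure0 _ _ _ _ _ (at_time t j `&` at_time t.+1 k)) => //.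
  - exact: measurableI.
  - by move=> w [[_ wj] wk].
  - by rewrite [LHS]run_law_step occE -EFinM occ_step_leave0.
rewrite (_ : C = set0) ?measure0//; apply/seteqP; split=> // w.
rewrite /C /hit /at_time /= => -[[[Bj Bk] wj] wk].
by move: jk; rewrite -wj -wk Bj; move/negP: Bk => ->.
Qed.

Lemma measurable_eventually_sat : measurable (eventually_sat M L phi).
Proof.
rewrite (_ : eventually_sat _ _ _ = \bigcup_t hit t).
  by apply: bigcup_measurable => t _; exact: measurable_hit.
by apply/seteqP; split=> w; [case=> t wt; exists t|case=> t _ wt; exists t].
Qed.

Lemma sat_mass_le_eventually nu t :
  ((sat_mass nu t)%:E <= run_law pi nu (eventually_sat M L phi))%E.
Proof.
rewrite -prob_hit le_measure ?inE//; first exact: measurable_hit.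
  exact: measurable_eventually_sat.
by move=> w wt; exists t.
Qed.

(** Adjoining to the events [hit t] the null event [N] of ever leaving the target
    makes them nondecreasing without changing their probabilities or their
    union, so continuity from below applies. *)
Lemma eventually_le nu c : (forall t, sat_mass nu t <= c) ->
  (run_law pi nu (eventually_sat M L phi) <= c%:E)%E.
Proof.
move=> mass_le; pose N := \bigcup_t (hit t `\` hit t.+1).
have mD t : measurable (hit t `\` hit t.+1).
  by apply: measurableD; exact: measurable_hit.
have mN : measurable N by apply: bigcup_measurable => t _; exact: mD.
have N0 : run_law pi nu N = 0%E.
  apply: measure_negligible => //; apply: negligible_bigcup => t.
  by apply/negligibleP; [exact: mD|exact: prob_leave].
pose G t := hit t `|` N.
have mG t : measurable (G t) by apply: measurableU => //; exact: measurable_hit.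
have UG : eventually_sat M L phi = \bigcup_t G t.
  apply/seteqP; split=> [w [t wt]|w]; first by exists t => //; left.
  by case=> t _ [wt|[i _ [wi _]]]; [exists t|exists i].
have ndG : nondecreasing_seq G.
  apply/nondecreasing_seqP => t; apply/subsetPset => w [wt|]; last by right.
  have [wt1|wt1] := pselect (hit t.+1 w); first by left.
  by right; exists t.
have mU := measurable_eventually_sat; rewrite UG in mU *.
apply: (cvge_to_le (nondecreasing_cvg_mu mG mU ndG)).
apply: nearW => t /=; rewrite measureU0//; last exact: measurable_hit.
by rewrite [leLHS]prob_hit lee_fin.
Qed.

Lemma reach_total_mixed nu eps Tmix T : return_mixed pi (reach_cost M L phi) eps Tmix ->
  (Tmix <= T)%N -> reach_total nu T <= reach_total nu Tmix + eps.
Proof.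
move=> mix leT; rewrite [leLHS]reach_total_linear [X in _ <= X + _]reach_total_linear.
rewrite -[eps]mul1r -(dist_sum1 nu) mulr_suml -big_split /=.
apply: ler_sum => s _; rewrite -mulrDr ler_wpM2l ?dist_ge0//.
have := mix T s leT; rewrite !expected_reach_costE -EFinB abse_EFin lee_fin.
by move=> /(le_trans (ler_norm _)); rewrite lerBlDl.
Qed.

End absorbing_target.

(** * Total cost and reachability *)

Theorem mainTheorem3 (R : realType) (S A : finType) (M : mdp R S A)
    (AP : Type) (L : S -> AP -> bool) (phi : formula AP)
    (p : R) (hp : 0 <= p <= 1) (b : comparison)
    (hsink : forall s, sat L s phi -> sink M s)
    (pi : policy M)
    (eps : R) (heps : 0 < eps < 1)
    (Tmix : nat) (hmix : is_return_mixing_time pi (reach_cost M L phi) eps Tmix)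
    (Teps : nat) (hTeps : (Tmix <= Teps)%N)
    (hcase :
      ((b = cmp_ge \/ b = cmp_gt) /\
       compare_with b (expected_cost pi (reach_cost M L phi) (init M) Teps) p%:E)
      \/
      ((b = cmp_le \/ b = cmp_lt) /\
       (forall s, sat L s phi -> init M s = 0) /\
       compare_with b (expected_cost pi (reach_cost M L phi) (init M) Teps)
         (p - eps)%:E)) :
  models_eventually L pi b p phi.
Proof.
have massE := sat_massE pi hsink (init M).
rewrite !expected_reach_costE in hcase.
case: hcase => [[hb hD]|[hb [init0 hD]]].
  have hU : ((reach_total L phi pi (init M) Teps)%:E <=
      run_law pi (init M) (eventually_sat M L phi))%E.
    apply: le_trans (sat_mass_le_eventually L phi pi (init M) Teps).
    by rewrite lee_fin massE lerDr sat_mass_ge0.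
  rewrite /models_eventually.
  case: hb hD => -> /= hD; first exact: le_trans hD hU.
  exact: lt_le_trans hD hU.
have mass0 : sat_mass L phi pi (init M) 0 = 0.
  by rewrite /sat_mass big1// => k /init0 /= ->; rewrite mul0r.
have hU : (run_law pi (init M) (eventually_sat M L phi) <=
    (reach_total L phi pi (init M) Teps + eps)%:E)%E.
  apply: eventually_le => // t; rewrite massE mass0 add0r.
  (* Mixing only compares horizons beyond [Tmix], hence the maximum. *)
  apply: le_trans (le_reach_total L phi pi _ (leq_maxl t Tmix)) _.
  apply: le_trans (reach_total_mixed _ (proj1 hmix) (leq_maxr t Tmix)) _.
  by rewrite lerD2r le_reach_total.
rewrite /models_eventually.
case: hb hD => -> /=; rewrite ?lee_fin ?lte_fin => hD.
  by apply: le_trans hU _; rewrite lee_fin -lerBrDr.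
by apply: le_lt_trans hU _; rewrite lte_fin -ltrBrDr.
Qed.
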